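(* Let $L(K_{4,4})$ denote the line graph of the complete bipartite graph $K_{4,4}$. For a positive integer $n$, there exists an $L(K_{4,4})$-design of order $n$ if and only if $n \equiv 1 \pmod{96}$.
   Context: The line graph $L(K_{4,4})$ has the 16 edges of $K_{4,4}$ as its vertices. Two of these vertices are adjacent if and only if the corresponding edges share an endpoint. Equivalently, it is the $4\times 4$ rook's graph $K_4 \,\square\, K_4$, which is 6-regular with 48 edges. For simple graphs $F$ and $G$, a $G$-decomposition of $F$ is a partition of the edge set of $F$ into classes, each of which is the edge set of a subgraph of $F$ isomorphic to $G$. A $G$-design of order $n$ is a $G$-decomposition of the complete graph $K_n$; for $n=1$, the empty decomposition counts as a $G$-design. *)

(* Defs.v *)
From mathcomp Require Import all_boot.
Set Implicit Arguments. Unset Strict Implicit. Unset Printing Implicit Defensive.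

(* A simple graph G is given by a finite vertex type T and an adjacency
   relation e (assumed symmetric and irreflexive for the graphs used). *)

(* The line graph L(K_{4,4}) = rook's graph K_4 [] K_4: vertices are the
   edges (i,j) of K_{4,4} (i in one side, j in the other); two are adjacent
   iff they are distinct and share an endpoint (same i or same j). *)
Definition LK44 : rel ('I_4 * 'I_4) :=
  fun x y => (x != y) && ((x.1 == y.1) || (x.2 == y.2)).

Definition in_copy (T : finType) (e : rel T) (n : nat)
    (f : {ffun T -> 'I_n}) (u v : 'I_n) : bool :=
  [exists x, exists y, [&& e x y, f x == u & f y == v]].

Definition is_design (T : finType) (e : rel T) (n : nat)
    (s : seq {ffun T -> 'I_n}) : Prop :=
  all (fun f : {ffun T -> 'I_n} => injectiveb f) s /\
  forall u v : 'I_n, u != v -> count (fun f => in_copy e f u v) s = 1.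

Definition has_design (T : finType) (e : rel T) (n : nat) : Prop :=
  exists s : seq {ffun T -> 'I_n}, is_design e s.

(* Main.v *)
Require Import Defs.
From mathcomp Require Import all_boot all_algebra zify.
Set Implicit Arguments. Unset Strict Implicit. Unset Printing Implicit Defensive.
Import GRing.Theory.

(* Necessity: the graph is 6-regular with 96 ordered edges, so 6 | n - 1 and
   96 | n (n - 1); then n is prime to 6, hence 96 | n - 1.

   Sufficiency, for n = 96 t + 1: the complete 4-partite graph K_4[4] splits
   into two rook's graphs, since two parallel classes of the affine plane AG(2,4)
   form one of them and the plane without its class of groups has four. From this,
   and from a decomposition of K_4[8], one gets decompositions of K_4[24] and
   K_5[24]. Truncate one group of a transversal design TD(5, 4 m) to 4 s points,
   s <= m, give weight 24 to all points and fill the groups together with a point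
   at infinity: designs of orders 96 m + 1 and 96 s + 1 yield one of order
   96 (4 m + s) + 1. The orders t = 1, 2, 3, 6, 7 that are not of the form 4 m + s
   for an available TD(5, 4 m) come from difference families, and t = 11 from a
   group divisible design with blocks of size 4 and 11 groups of size 24. *)

(** * Decompositions of a relation into copies of a graph, and their transport *)

Definition covers (V T : finType) (e : rel V) (b : V -> T) (x y : T) :=
  [exists u, exists v, [&& e u v, b u == x & b v == y]].

(** The count is prescribed on all ordered pairs, diagonal included, so a non-edge of [w] lies in no
    block. *)
Definition decomposable (V T : finType) (e : rel V) (w : rel T) : Prop :=
  exists2 L : seq {ffun V -> T}, all (fun b : {ffun V -> T} => injectiveb b) L &
    forall x y, count (fun b : {ffun V -> T} => covers e b x y) L = w x y.

Lemma coversP (V T : finType) (e : rel V) (b : V -> T) x y :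
  reflect (exists u v, [/\ e u v, b u = x & b v = y]) (covers e b x y).
Proof.
apply: (iffP existsP) => [[u /existsP[v /and3P[euv /eqP bu /eqP bv]]]|].
  by exists u, v.
by case=> u [v [euv bu bv]]; exists u; apply/existsP; exists v; rewrite euv bu bv !eqxx.
Qed.

Section Operations.
Variables (V : finType) (e : rel V).

Lemma eq_decomposable (T : finType) (w w' : rel T) :
  w =2 w' -> decomposable e w -> decomposable e w'.
Proof. by move=> ww' [L Linj cL]; exists L => // x y; rewrite cL ww'. Qed.

Lemma decomposable_sum (I T : finType) (w_ : I -> rel T) (w : rel T) :
    (forall i, decomposable e (w_ i)) ->
    (forall x y, \sum_i w_ i x y = w x y) ->
  decomposable e w.
Proof.
move=> /fin_all_exists2[L_ Linj cL] sum_w.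
exists (flatten [seq L_ i | i <- enum I]).
  by apply/allP => b /flattenP[_ /mapP[i _ ->] /(allP (Linj i))].
move=> x y; rewrite -sum_w count_flatten -map_comp sumnE big_map big_enum /=.
by apply: eq_bigr => i _; rewrite cL.
Qed.

(** Blocks are composed with [h]; a pair outside the image of [h] is covered neither by them nor by
    the image of [w]. *)
Lemma decomposable_push (S T : finType) (h : S -> T) (w : rel S) :
  injective h -> decomposable e w -> decomposable e (covers w h).
Proof.
move=> h_inj [L Linj cL].
exists [seq [ffun v => h (b v)] | b : {ffun V -> S} <- L].
  rewrite all_map; apply/allP => b /(allP Linj)/injectiveP b_inj /=.
  by apply/injectiveP => u v; rewrite !ffunE => /h_inj/b_inj.
move=> x y; rewrite count_map.
case: (boolP [exists p, exists q, (h p == x) && (h q == y)]) => [|no].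
  case/existsP=> p /existsP[q /andP[/eqP<- /eqP<-]].
  transitivity (nat_of_bool (w p q)).
    rewrite -cL; apply: eq_count => b /=.
    apply/coversP/coversP => -[u [v [euv]]]; rewrite ?ffunE.
      by move=> /h_inj<- /h_inj<-; exists u, v.
    by move=> bu bv; exists u, v; rewrite !ffunE bu bv.
  congr nat_of_bool; apply/idP/coversP => [wpq|[p' [q' []]]]; first by exists p, q.
  by move=> ? /h_inj<- /h_inj<-.
have no' p q : h p = x -> h q = y -> False.
  move=> hp hq; case/negP: no; apply/existsP; exists p.
  by apply/existsP; exists q; rewrite hp hq !eqxx.
transitivity 0.
  apply/eqP; rewrite -leqn0 leqNgt -has_count; apply/hasPn => b _ /=.
  by apply/coversP => -[u [v []]]; rewrite !ffunE => _ /no' + /[dup] => /[apply].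
by case: coversP => // -[p [q [_ /no' + /[dup]]]] => /[apply].
Qed.

Lemma decomposable_bij (S T : finType) (h : S -> T) (w : rel S) (w' : rel T) :
    bijective h -> (forall x y, w x y = w' (h x) (h y)) ->
  decomposable e w -> decomposable e w'.
Proof.
move=> [k hK kK] ww' /(decomposable_push (can_inj hK)).
apply: eq_decomposable => x y; apply/coversP/idP => [[p [q []]]|wxy].
  by rewrite ww' => w'pq <- <-.
by exists (k x), (k y); rewrite ww' !kK.
Qed.

Definition complete (T : finType) : rel T := fun x y => x != y.
Definition complete_on (T : finType) (A : {pred T}) : rel T :=
  fun x y => [&& x \in A, y \in A & x != y].

Lemma decomposable_complete_on (T : finType) (A : {pred T}) n :
  #|A| = n -> decomposable e (@complete 'I_n) -> decomposable e (complete_on A).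
Proof.
move=> <- /(decomposable_push (@enum_val_inj T A)); apply: eq_decomposable => x y.
apply/coversP/and3P => [[p [q [npq <- <-]]]|[Ax Ay nxy]].
  by rewrite !enum_valP; split=> //; apply: contraNneq npq => /enum_val_inj->.
exists (enum_rank_in Ax x), (enum_rank_in Ax y).
rewrite !enum_rankK_in //; split=> //.
by apply: contraNneq nxy => eqr; rewrite -(enum_rankK_in Ax Ax) eqr enum_rankK_in.
Qed.

(* The hypothesis on [e] forces the vertices of every block into [A]. *)
Lemma decomposable_complete_card (T : finType) (A : {pred T}) n :
    (forall u, exists v, e u v) -> #|A| = n.+1 ->
  decomposable e (complete_on A) -> decomposable e (@complete 'I_n.+1).
Proof.
move=> no_isolated cardA [L Linj cL].
have [x0 Ax0] : exists x, x \in A by apply/card_gt0P; rewrite cardA.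
have inA b u : b \in L -> b u \in A.
  move=> Lb; have [v euv] := no_isolated u.
  suff: 0 < complete_on A (b u) (b v) by rewrite lt0b => /and3P[].
  rewrite -cL -has_count; apply/hasP; exists b => //.
  by apply/coversP; exists u, v.
rewrite -cardA; exists [seq [ffun v => enum_rank_in Ax0 (b v)] | b : {ffun V -> T} <- L].
  rewrite all_map; apply/allP => b Lb /=; apply/injectiveP => u v; rewrite !ffunE.
  move/(congr1 enum_val); rewrite !enum_rankK_in ?inA //.
  by apply/injectiveP/(allP Linj).
move=> x y; rewrite count_map.
transitivity (nat_of_bool (complete_on A (enum_val x) (enum_val y))); last first.
  by rewrite /complete_on !enum_valP /= (inj_eq enum_val_inj).
rewrite -cL; apply: eq_in_count => b Lb /=.
apply/coversP/coversP => -[u [v [euv]]]; rewrite ?ffunE => bu bv; exists u, v.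
  by rewrite -bu -bv !enum_rankK_in ?inA.
by rewrite !ffunE bu bv !enum_valK_in.
Qed.
End Operations.

(** * Blow-ups, transversal products and filling of groups *)

Definition blowup (T : finType) (w : rel T) (U : finType) : rel (T * U) :=
  fun x y => w x.1 y.1.

(** Wilson's weighting: the blow-ups of the copies of [f] partition the blow-up of [w], and each of
    them is decomposed separately. *)
Lemma decomposable_blowup (V W T U : finType) (e : rel V) (f : rel W) (w : rel T) :
    decomposable f w -> decomposable e (@blowup W f U) ->
  decomposable e (@blowup T w U).
Proof.
move=> [L Linj cL] deco_f.
have L_inj (i : 'I_(size L)) : injective (tnth (in_tuple L) i).
  by apply/injectiveP/(allP Linj)/mem_tnth.
pose h i (x : W * U) := (tnth (in_tuple L) i x.1, x.2).
apply: (@decomposable_sum V e _ _ (fun i => covers (@blowup W f U) (h i))) => [i|x y].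
  apply: decomposable_push deco_f.
  by move=> [x u] [y v] [/L_inj-> ->].
rewrite /blowup -cL -sum1_count (big_tnth _ _ L) [RHS]big_mkcond /=.
apply: eq_bigr => i _.
suff -> : covers (fun x y : W * U => f x.1 y.1) (h i) x y = covers f (tnth (in_tuple L) i) x.1 y.1.
  by case: covers.
apply/coversP/coversP => [[p [q [fpq <- <-]]]|[p [q [fpq hp hq]]]].
  by exists p.1, q.1.
exists (p, x.2), (q, y.2); split=> //.
  by rewrite /h /= hp; case: (x).
by rewrite /h /= hq; case: (y).
Qed.

Definition multipartite (I U : finType) (P : I -> pred U) : rel (I * U) :=
  fun x y => [&& P x.1 x.2, P y.1 y.2 & x.1 != y.1].

(* Product of a transversal design, possibly with truncated groups, with
   decompositions of complete multipartite graphs. *)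
Lemma decomposable_transversal (V I T U : finType) (e : rel V)
    (f : I -> T * T -> T) (P : I -> pred T) :
    (forall i j x y, i != j -> P i x -> P j y ->
      injective (fun ab => (f i ab, f j ab))) ->
    (forall ab, decomposable e
      (@multipartite I U (fun i _ => P i (f i ab)))) ->
  decomposable e (@multipartite I (T * U)%type (fun i x => P i x.1)).
Proof.
move=> f_inj decoP.
pose h ab (x : I * U) := (x.1, (f x.1 ab, x.2)).
apply: (@decomposable_sum V e _ _ (fun ab =>
    covers (@multipartite I U (fun i _ => P i (f i ab))) (h ab))) => [ab|].
  apply: decomposable_push (decoP ab).
  by move=> [i u] [j v] [<- _ <-].
move=> [i [x u]] [j [y v]]; rewrite /multipartite /=.
have hE ab : covers (multipartite (fun i _ => P i (f i ab))) (h ab) (i, (x, u)) (j, (y, v))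
    = [&& P i x, P j y & i != j] && ((f i ab, f j ab) == (x, y)).
  apply/coversP/andP => [[[i' u'] [[j' v'] []]]|[Pij /eqP[fi fj]]].
    by rewrite /multipartite /= => Pij [<- <- _] [<- <- _].
  by exists (i, u), (j, v); rewrite /multipartite /h /= fi fj.
under eq_bigr => ab _ do rewrite hE.
have [/and3P[Pi Pj nij]|_] := boolP [&& P i x, P j y & i != j]; last by rewrite big1.
(* An injective self-map of the finite set [T * T] is bijective: exactly one block passes through
   [x] in group [i] and [y] in group [j]. *)
have [g gK hK] := injF_bij (f_inj i j x y nij Pi Pj).
rewrite (bigD1 (g (x, y))) //= hK eqxx big1 // => ab.
by apply: contraNeq; rewrite eqb0 negbK => /eqP<-; rewrite gK.
Qed.

(* The vertex [None] is the point at infinity, common to the filled groups. *)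
Lemma decomposable_fill (V I T : finType) (e : rel V) (P : I -> pred T) :
    (forall u, exists v, e u v) ->
    decomposable e (multipartite P) ->
    (forall i, decomposable e (@complete 'I_(#|P i|).+1)) ->
  decomposable e (@complete 'I_(\sum_i #|P i|).+1).
Proof.
move=> no_isolated decoP decoi.
pose A : {pred option (I * T)} := fun z => if z is Some x then P x.1 x.2 else true.
pose B i : {pred option (I * T)} :=
  fun z => if z is Some x then (x.1 == i) && P x.1 x.2 else true.
have cardB i : #|B i| = #|P i|.+1.
  rewrite (cardD1 None) -[None \in B i]/true add1n; congr _.+1.
  rewrite -(card_imset (P i) (_ : injective (fun x => Some (i, x)))); last by move=> ? ? [].
  apply: eq_card => -[[j x]|]; rewrite !inE /=; last by apply/esym/imsetP => -[].
  rewrite /in_mem /=; apply/andP/imsetP => [[/eqP-> Px]|[y Py [-> ->]]]; last by [].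
  by exists x.
have cardA : #|A| = (\sum_i #|P i|).+1.
  rewrite (cardD1 None) -[None \in A]/true add1n; congr _.+1.
  transitivity #|[set x : I * T | P x.1 x.2]|.
    rewrite -(card_imset _ (@Some_inj _)).
    apply: eq_card => -[x|]; rewrite !inE /=; last by apply/esym/imsetP => -[].
    by rewrite mem_imset ?inE //; apply: Some_inj.
  rewrite -sum1_card.
  transitivity (\sum_i \sum_(x | P i x) 1).
    by rewrite pair_big_dep /=; apply: eq_bigl => x; rewrite inE.
  by apply: eq_bigr => i _; rewrite sum1_card.
apply: decomposable_complete_card cardA _ => //.
(* The piece [None] is the multipartite graph; the piece [Some i] is the complete graph on group [i]
   and the point at infinity. *)
apply: (@decomposable_sum V e (option I) _ (fun o =>
   if o is Some i then complete_on (B i) else covers (multipartite P) Some)).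
  case=> [i|]; last exact: decomposable_push (@Some_inj _) decoP.
  exact: decomposable_complete_on (cardB i) _.
move=> x y.
have cSome x' y' : covers (multipartite P) Some (Some x') (Some y') = multipartite P x' y'.
  by apply/coversP/idP => [[p [q [? [<-] [<-]]]] //|?]; exists x', y'.
have cNone x' y' : x' = None \/ y' = None -> covers (multipartite P) Some x' y' = false.
  by move=> xy; apply/coversP => -[p [q [_ px qy]]]; case: xy; rewrite -?px -?qy.
have pick_sum o0 (w : option I -> bool) : w o0 -> (forall o, w o -> o = o0) ->
    \sum_o w o = 1.
  move=> wo0 w_eq; rewrite (bigD1 o0) //= wo0 big1 // => o.
  by apply: contraNeq; rewrite eqb0 negbK => /w_eq->.
(* Outside [complete_on A] no piece contains the pair. Inside it exactly one does: that of the
   common group, the multipartite one for two groups, or that of the finite point when the other is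
   infinity. *)
case xy: (complete_on A x y); last first.
  rewrite big1 // => o _; apply/eqP; rewrite eqb0; apply: contraFN xy.
  case: o => [i|]; rewrite /complete_on /in_mem /=; first last.
    case/coversP=> p [q [/and3P[Pp Pq npq] <- <-]] /=; rewrite Pp Pq /=.
    by apply: contraNneq npq => -[->].
  case: x => [x|]; case: y => [y|] //=.
  - by case/and3P=> /andP[_ ->] /andP[_ ->].
  - by case/andP=> /andP[_ ->].
  - by case/andP=> /andP[_ ->].
case/and3P: xy; rewrite /in_mem /=.
case: x => [[i x]|]; case: y => [[j y]|] //= Px Py nxy.
- have [eij|nij] := eqVneq i j.
    rewrite {i}eij in Px nxy *.
    apply: (pick_sum (Some j)); first by rewrite /complete_on /in_mem /= eqxx Px Py.
    case=> [k|]; last by rewrite cSome /multipartite /= eqxx !andbF.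
    by case/and3P => /andP[/eqP <-].
  apply: (pick_sum None); first by rewrite cSome /multipartite /= Px Py nij.
  case=> // k /and3P[/andP[/eqP /= ik _] /andP[/eqP /= jk _]].
  by rewrite ik jk eqxx in nij.
- apply: (pick_sum (Some i)); first by rewrite /complete_on /in_mem /= eqxx Px.
  case=> [k|]; last by rewrite cNone //; right.
  by case/and3P => /andP[/eqP <-].
apply: (pick_sum (Some j)); first by rewrite /complete_on /in_mem /= eqxx Py.
case=> [k|]; last by rewrite cNone //; left.
by case/and3P => _ /andP[/eqP <-].
Qed.

(** * Transversal designs *)

(* [f i ab] is the point in which the block [ab] meets the [i]-th group. *)
Definition transversal (k : nat) (T : finType) (f : 'I_5 -> T * T -> T) : Prop :=
  forall i j : 'I_5, i < k -> j < k -> i != j -> injective (fun ab => (f i ab, f j ab)).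

Definition has_transversal (k n : nat) : Prop :=
  exists T : finType, exists2 f : 'I_5 -> T * T -> T, transversal k f & #|T| = n.

(** MacNeish's product, taken coordinatewise. *)
Lemma has_transversalM k m n :
  has_transversal k m -> has_transversal k n -> has_transversal k (m * n).
Proof.
move=> [T [f tf <-]] [U [g tg <-]].
pose fg i (ab : (T * U) * (T * U)) :=
  (f i (ab.1.1, ab.2.1), g i (ab.1.2, ab.2.2)).
exists (T * U)%type; exists fg; last by rewrite card_prod.
move=> i j ik jk nij [[a a'] [b b']] [[c c'] [d d']] [fi gi fj gj].
have [-> ->] : (a, b) = (c, d) by apply: (tf i j) => //=; rewrite fi fj.
by have [-> ->] : (a', b') = (c', d') by apply: (tg i j) => //=; rewrite gi gj.
Qed.

Section LinearTransversal.
Local Open Scope ring_scope.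

(** The groups are read off by [a + i * b] for [i < 4] and by [b] modulo [m]. Two of the slopes
    differ by 1, 2 or 3, which is invertible modulo [m]. *)
Lemma has_transversal_linear (m : nat) : (0 < m)%N -> coprime m 6 -> has_transversal 5 m.
Proof.
case: m => // m _ m6; exists 'I_m.+1.
pose f (i : 'I_5) (ab : 'I_m.+1 * 'I_m.+1) :=
  if (i < 4)%N then ab.1 + ab.2 *+ i else ab.2.
exists f; last by rewrite card_ord.
have mulrnI (k : nat) (x : 'I_m.+1) : (0 < k < 4)%N -> x *+ k = 0 -> x = 0.
  move=> k4 /(congr1 val); rewrite Zp_mulrn /= => /eqP xk0.
  have mk : coprime m.+1 k.
    by apply: coprime_dvdr m6; case: k k4 {xk0} => [|[|[|[|]]]].
  apply/val_inj/eqP; rewrite /= -[_ == _]/(nat_of_ord x == 0)%N.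
  move: xk0; rewrite -/(dvdn _ _) Gauss_dvdl // => /dvdn_leq.
  by case: (posnP x) => [->|x0 /(_ isT)] //; rewrite leqNgt ltn_ord.
have lin (i j : nat) (a b c d : 'I_m.+1) : (i < 4)%N -> (i < j < 4)%N ->
    a + b *+ i = c + d *+ i -> a + b *+ j = c + d *+ j -> (a, b) = (c, d).
  move=> i4 /andP[ij j4] Ei Ej; have /subr0_eq bd : b - d = 0.
    apply: (mulrnI (j - i)%N); first by lia.
    have H k : a + b *+ k = c + d *+ k -> (b - d) *+ k = c - a.
      by move=> E; rewrite mulrnBl -[b *+ k](addKr a) E addrA addrK addrC.
    by rewrite mulrnBr 1?ltnW // !H // subrr.
  by move: Ei; rewrite bd => /addIr->.
move=> i j _ _ nij [a b] [c d] [].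
wlog ij : i j nij / (i < j)%N.
  move=> W Ei Ej; have := nij; rewrite -val_eqE neq_ltn => /orP[ij|ji].
    exact: (W i j).
  by apply: (W j i); rewrite // eq_sym.
rewrite /f /=. have i4 : (i < 4)%N by have := ltn_ord j; lia.
rewrite i4.
case: ifP => j4; first by apply: lin; rewrite // ij.
by move=> Ei bd; move: Ei; rewrite bd => /addIr->.
Qed.

End LinearTransversal.

Lemma uniq_map_inj_in (T1 T2 : eqType) (f : T1 -> T2) (s : seq T1) :
  uniq (map f s) -> {in s &, injective f}.
Proof.
elim: s => //= x s IHs /andP[fx us] y z; rewrite !inE.
move=> /predU1P[-> | sy] /predU1P[-> | sz] // fyz; last exact: IHs.
  by rewrite fyz map_f in fx.
by rewrite -fyz map_f in fx.
Qed.

(** A certificate for computation: pairs of entries are coded in base [n], and strict increase after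
    sorting shows that the codes are distinct. *)
Lemma has_transversal_table k (n : nat) (F : nat -> nat -> nat -> nat) :
    let cells := [seq (a, b) | a <- iota 0 n, b <- iota 0 n] in
    all (fun i => all (fun ab => F i ab.1 ab.2 < n) cells) (iota 0 k) ->
    all (fun ij => (ij.1 < ij.2) ==>
        sorted ltn (sort leq [seq F ij.1 ab.1 ab.2 * n + F ij.2 ab.1 ab.2 | ab <- cells]))
      [seq (i, j) | i <- iota 0 k, j <- iota 0 k] ->
  has_transversal k n.
Proof.
case: n => [|n] cells; first by move=> _ _; exists void; exists (fun _ ab => ab.1); [move=> ? ? _ _ _ [[]]|rewrite card_void].
move=> Flt Fsort; exists 'I_n.+1.
pose f (i : 'I_5) (ab : 'I_n.+1 * 'I_n.+1) : 'I_n.+1 := inord (F i ab.1 ab.2).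
have in_cells (ab : 'I_n.+1 * 'I_n.+1) : (nat_of_ord ab.1, nat_of_ord ab.2) \in cells.
  by apply: allpairs_f; rewrite mem_iota /=.
have fE (i : 'I_5) ab : i < k -> f i ab = F i ab.1 ab.2 :> nat.
  move=> ik; rewrite inordK //.
  have ki : nat_of_ord i \in iota 0 k by rewrite mem_iota.
  exact: (allP (allP Flt _ ki) _ (in_cells ab)).
exists f; last by rewrite card_ord.
move=> i j ik jk nij ab cd.
wlog ij : i j ik jk nij / i < j.
  move=> W Eij; have := nij; rewrite -val_eqE neq_ltn => /orP[ij|ji].
    exact: (W i j).
  by apply: (W j i) => //; [rewrite eq_sym|case: Eij => -> ->].
case=> /(congr1 val) /= Ei /(congr1 val) /= Ej; rewrite !fE // in Ei Ej.
have kij : (nat_of_ord i, nat_of_ord j) \in [seq (i, j) | i <- iota 0 k, j <- iota 0 k].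
  by apply: allpairs_f; rewrite mem_iota.
have /implyP/(_ ij)/(sorted_uniq ltn_trans ltnn) := allP Fsort _ kij.
rewrite sort_uniq => u.
have [] : (ab.1 : nat, ab.2 : nat) = (cd.1 : nat, cd.2 : nat).
  by apply: (uniq_map_inj_in u); rewrite ?in_cells //= Ei Ej.
by case: ab cd {Ei Ej} => [a b] [c d] /= /val_inj-> /val_inj->.
Qed.

(** * The recursive step for orders 96 t + 1 *)

Lemma LK44_no_isolated u : exists v, LK44 u v.
Proof.
case: u => i j; exists (if i == ord0 then lift ord0 ord0 else ord0, j).
rewrite /LK44 /= eqxx orbT andbT xpair_eqE eqxx andbT.
by case: ifP => [/eqP-> //|->].
Qed.

Definition designable t := decomposable LK44 (@complete 'I_(96 * t).+1).

(** There are five groups also for [k = 4], the last one then being isolated, so that blocks meeting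
    or missing the truncated group share one vertex type. *)
Definition multipartite24 k :=
  decomposable LK44 (@multipartite 'I_5 'I_24 (fun i _ => i < k)).

Lemma decomposable_multipartite_card (V I U U' : finType) (e : rel V) (A : pred I) :
    #|U| = #|U'| -> decomposable e (@multipartite I U (fun i _ => A i)) ->
  decomposable e (@multipartite I U' (fun i _ => A i)).
Proof.
move=> cardU; pose g (u : U) : U' := enum_val (cast_ord cardU (enum_rank u)).
have g_inj : injective g by move=> u v /enum_val_inj/cast_ord_inj/enum_rank_inj.
have g_bij : bijective g by apply: inj_card_bij; rewrite ?cardU.
apply: (@decomposable_bij _ _ _ _ (fun x => (x.1, g x.2))) => //.
case: g_bij => h gK hK; exists (fun x => (x.1, h x.2)) => -[i x] /=; by rewrite ?gK ?hK.
Qed.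

(* The last group of a transversal design is truncated to [4 * s] points, and
   every point is given weight 24. *)
Lemma designable_step m s :
    multipartite24 4 -> multipartite24 5 -> has_transversal 5 (4 * m) -> s <= m ->
    designable m -> designable s ->
  designable (4 * m + s).
Proof.
move=> mp4 mp5 [T [f tf cardT]] sm Dm Ds.
have [A cardA] : exists A : {set T}, #|A| = 4 * s.
  exists [set x in take (4 * s) (enum T)]; rewrite cardsE.
  have /card_uniqP-> : uniq (take (4 * s) (enum T)) by rewrite take_uniq ?enum_uniq.
  by rewrite size_takel // -cardE cardT leq_mul2l.
pose P (i : 'I_5) (x : T) := (i < 4) || (x \in A).
have decoP : decomposable LK44 (@multipartite 'I_5 (T * 'I_24)%type (fun i x => P i x.1)).
  apply: (decomposable_transversal (f := f)) => [i j x y nij _ _|ab].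
    by apply: tf; rewrite ?ltn_ord.
  (* A block keeps five points if its point in the last group survives, and four otherwise. *)
  have [Aab|nAab] := boolP (f ord_max ab \in A).
    apply: eq_decomposable mp5 => -[i u] [j v]; rewrite /multipartite /P /=.
    have P1 (k : 'I_5) : (k < 4) || (f k ab \in A) = (k < 5).
      rewrite ltn_ord; have [//|k4] := ltnP k 4.
      by rewrite (_ : k = ord_max) //; apply/val_inj => /=; have := ltn_ord k; lia.
    by rewrite !P1.
  apply: eq_decomposable mp4 => -[i u] [j v]; rewrite /multipartite /P /=.
  have P1 (k : 'I_5) : (k < 4) || (f k ab \in A) = (k < 4).
    have [//|k4] := ltnP k 4.
    by rewrite (_ : k = ord_max) ?(negPf nAab) //; apply/val_inj => /=; have := ltn_ord k; lia.
  by rewrite !P1.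
(* With weight 24, groups of [4 * m] and [4 * s] points become groups of [96 * m] and [96 * s]. *)
have cardP (i : 'I_5) : #|(fun x : T * 'I_24 => P i x.1) : pred _| = 96 * (if i < 4 then m else s).
  transitivity #|setX (if i < 4 then setT else A) [set: 'I_24]|.
    apply: eq_card => -[x u]; rewrite in_setX in_setT andbT -[LHS]/(P i x) /P.
    by case: ifP => _; rewrite ?in_setT.
  by rewrite cardsX [X in _ * X]cardsT card_ord; case: ifP; rewrite ?cardsT ?cardT ?cardA; lia.
rewrite /designable.
have -> : 96 * (4 * m + s) = \sum_(i < 5) #|(fun x : T * 'I_24 => P i x.1) : pred _|.
  by under eq_bigr => i _ do rewrite cardP; rewrite !big_ord_recl big_ord0 /=; lia.
apply: decomposable_fill LK44_no_isolated decoP _ => i.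
by rewrite cardP; case: ifP.
Qed.

(** * Developing base blocks under a group *)

Section Develop.
Variables (V : finType) (e : rel V) (m : nat) (enc : V -> nat) (en : rel nat).
Hypotheses (enc_inj : injective enc) (enc_lt : forall v, enc v < m) (cardV : #|V| = m).
Hypothesis enE : forall u v, e u v = en (enc u) (enc v).

Lemma sum_enc (F : nat -> nat) : \sum_v F (enc v) = \sum_(k <- iota 0 m) F k.
Proof.
rewrite -(big_map enc predT) /=; apply: perm_big.
have uenc : uniq [seq enc v | v <- index_enum V].
  by rewrite map_inj_uniq // index_enum_uniq.
apply: uniq_perm => //; first exact: iota_uniq.
have senc : {subset [seq enc v | v <- index_enum V] <= iota 0 m}.
  by move=> k /mapP[v _ ->]; rewrite mem_iota enc_lt.
have [] // := uniq_min_size uenc senc.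
by rewrite size_iota size_map -cardV cardT enumT.
Qed.

Definition edges := [seq p <- [seq (k, l) | k <- iota 0 m, l <- iota 0 m] | en p.1 p.2].

Lemma sum_edges (F : nat -> nat -> nat) :
  \sum_u \sum_v (e u v * F (enc u) (enc v)) = \sum_(p <- edges) F p.1 p.2.
Proof.
rewrite big_filter [RHS]big_mkcond big_allpairs /=.
rewrite -(sum_enc (fun k => \sum_(l <- iota 0 m) if en k l then F k l else 0)).
apply: eq_bigr => u _; rewrite -(sum_enc (fun l => if en (enc u) l then F (enc u) l else 0)).
by apply: eq_bigr => v _; rewrite enE; case: en; rewrite ?mul1n.
Qed.

(** Injectivity leaves at most one ordered edge above [(x, y)], so the boolean is a sum and sums can
    be exchanged. *)
Lemma covers_sum (T : finType) (b : V -> T) x y : injective b ->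
  covers e b x y = \sum_u \sum_v e u v * ((b u == x) && (b v == y)) :> nat.
Proof.
move=> b_inj; case: coversP => [[u [v [euv <- <-]]]|no].
  rewrite (bigD1 u) //= (bigD1 v) //= euv !eqxx big1 => [|v' nv']; last first.
    by rewrite (inj_eq b_inj v') (negPf nv') andbF muln0.
  rewrite big1 // => u' nu'; rewrite big1 // => v' _.
  by rewrite (inj_eq b_inj u') (negPf nu') muln0.
rewrite big1 // => u _; rewrite big1 // => v _.
case euv: (e u v) => //=; case: eqP => // bu; case: eqP => // bv.
by case: no; exists u, v.
Qed.

(* Blocks are lists of labels below [n], one for each vertex of [V]; [q] is a
   complete invariant of the diagonal action of [G] on ordered pairs. *)
Lemma decomposable_develop (T G : finType) (act : G -> T -> T) (q : T -> T -> nat)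
    (n : nat) (c : nat -> T) (qn : nat -> nat -> nat) (blocks : seq (seq nat))
    (N : nat) (a : pred nat) (w : rel T) :
    (forall g, injective (act g)) ->
    (forall x y x' y',
      \sum_g ((act g x == x') && (act g y == y')) = (q x y == q x' y')) ->
    {in gtn n &, injective c} ->
    {in gtn n &, forall k l, q (c k) (c l) = qn k l} ->
    all (fun s => [&& size s == m, uniq s & all (gtn n) s]) blocks ->
    sort leq [seq qn (nth 0 s p.1) (nth 0 s p.2) | s <- blocks, p <- edges] =
      [seq d <- iota 0 N | a d] ->
    (forall x y, w x y = (q x y < N) && a (q x y)) ->
  decomposable e w.
Proof.
move=> act_inj actq c_inj qE Bok Bsort wE.
have lab s v : s \in blocks -> nth 0 s (enc v) < n.
  move=> /(allP Bok)/and3P[/eqP size_s _ /allP s_lt].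
  by apply/s_lt/mem_nth; rewrite size_s.
have b_inj s g : s \in blocks -> injective (fun v => act g (c (nth 0 s (enc v)))).
  move=> sB u v /act_inj/c_inj/eqP; rewrite !inE !lab // => /(_ isT isT).
  move: (allP Bok s sB) => /and3P[/eqP size_s us _].
  by rewrite nth_uniq ?size_s // => /eqP/enc_inj.
exists [seq [ffun v => act g (c (nth 0 s (enc v)))] | s <- blocks, g <- enum G].
  apply/allP => _ /allpairsP[[s g] /= [sB _ ->]]; apply/injectiveP => u v.
  by rewrite !ffunE => /b_inj; apply.
(* The blocks covering [(x, y)] are counted by the edges of base blocks with invariant [q x y]; the
   sorted list is free of repetitions. *)
move=> x y; transitivity (count_mem (q x y)
    [seq qn (nth 0 s p.1) (nth 0 s p.2) | s <- blocks, p <- edges]); last first.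
  rewrite -(permP (permEl (perm_sort leq _))) Bsort.
  rewrite count_uniq_mem ?filter_uniq ?iota_uniq // mem_filter mem_iota wE.
  by rewrite andbC.
rewrite -!sum1_count [LHS]big_mkcond [RHS]big_mkcond /= !big_allpairs_dep /=.
apply: eq_big_seq => s sB.
rewrite -(sum_edges (fun k l => if pred1 (q x y) (qn (nth 0 s k) (nth 0 s l)) then 1 else 0)).
rewrite big_enum /=.
have coversE g : (if covers e [ffun v => act g (c (nth 0 s (enc v)))] x y then 1 else 0)
   = \sum_u \sum_v e u v * ((act g (c (nth 0 s (enc u))) == x)
                         && (act g (c (nth 0 s (enc v))) == y)).
  rewrite -covers_sum; last exact: b_inj.
  rewrite -[RHS]/(nat_of_bool _); congr (nat_of_bool _).
  by apply/coversP/coversP=> -[u [v [? <- <-]]]; exists u, v; rewrite ?ffunE.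
under eq_bigr => g _ do rewrite coversE.
(* For a fixed edge of the base block, [actq] counts the group elements carrying it to [(x, y)]: one
   if the invariants agree, none otherwise. *)
rewrite exchange_big; apply: eq_bigr => u _.
rewrite exchange_big; apply: eq_bigr => v _.
by rewrite -big_distrr /= actq qE ?inE ?lab //.
Qed.

Definition label_point p r k : 'I_p.+1 * 'I_r.+1 := (inZp (k %/ r.+1), inZp (k %% r.+1)).

Lemma label_point_inj p r : {in gtn (p.+1 * r.+1) &, injective (@label_point p r)}.
Proof.
move=> k l; rewrite !inE => kn ln [].
rewrite !modn_mod !(@modn_small (_ %/ _)) ?ltn_divLR // => kl1 kl2.
by rewrite (divn_eq k r.+1) kl1 kl2 -divn_eq.
Qed.

(** The case of the trivial group: all blocks are listed, and a pair coded in base [n] is its own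
    invariant. *)
Lemma decomposable_table p r (blocks : seq (seq nat)) (a : rel nat) (n := p.+1 * r.+1)
    (w : rel ('I_p.+1 * 'I_r.+1)) :
    all (fun s => [&& size s == m, uniq s & all (gtn n) s]) blocks ->
    sort leq [seq nth 0 s p.1 * n + nth 0 s p.2 | s <- blocks, p <- edges] =
      [seq d <- iota 0 (n * n) | a (d %/ n) (d %% n)] ->
    (forall x y, w x y = a (x.1 * r.+1 + x.2) (y.1 * r.+1 + y.2)) ->
  decomposable e w.
Proof.
move=> Bok Bsort wE.
pose cod (x : 'I_p.+1 * 'I_r.+1) := x.1 * r.+1 + x.2.
have cod_lt x : cod x < n by have := ltn_ord x.1; have := ltn_ord x.2; rewrite /cod /n; nia.
have codK k : k < n -> cod (label_point p r k) = k.
  by move=> kn; rewrite /cod /= modn_mod modn_small ?ltn_divLR // -divn_eq.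
have cod_inj : injective cod.
  move=> [x x'] [y y'] xy; congr pair; apply/val_inj.
    by have := congr1 (divn^~ r.+1) xy; rewrite !divnMDl // !divn_small // !addn0.
  by have := congr1 (modn^~ r.+1) xy; rewrite !modnMDl !modn_small.
have n0 : 0 < n by [].
apply: (@decomposable_develop _ unit (fun _ => id) (fun x y => cod x * n + cod y) n
  (@label_point p r) (fun k l => k * n + l) blocks (n * n)
  (fun d => a (d %/ n) (d %% n)) w) => //.
- by move=> _ x y.
- move=> x y x' y'; rewrite (bigD1 tt) //= big1 => [|[]] //; rewrite addn0; congr nat_of_bool.
  rewrite -!(inj_eq cod_inj); have := cod_lt x; have := cod_lt x'.
  have := cod_lt y; have := cod_lt y'.
  move: (cod x) (cod x') (cod y) (cod y') => i i' j j' j'n jn i'n ijn.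
  apply/andP/eqP => [[/eqP-> /eqP->] //|E]; split; apply/eqP.
    by have := congr1 (divn^~ n) E; rewrite !divnMDl // !divn_small // !addn0.
  by have := congr1 (modn^~ n) E; rewrite !modnMDl !modn_small.
- exact: label_point_inj.
- by move=> k l; rewrite !inE => kn ln; rewrite !codK.
- move=> x y; rewrite divnMDl // divn_small // modnMDl modn_small // addn0 -wE.
  suff -> : cod x * n + cod y < n * n by [].
  by have := cod_lt x; have := cod_lt y; nia.
Qed.

(** The product of the cyclic groups of orders [p.+1] and [r.+1] acts on itself by translations, and
    the invariant of a pair is its difference. On labels, [qn] adds a complement to the modulus,
    since subtraction on [nat] truncates. *)
Lemma decomposable_difference p r (blocks : seq (seq nat)) (a : pred nat) (n := p.+1 * r.+1)
    (w : rel ('I_p.+1 * 'I_r.+1)) :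
    let qn k l := (l %/ r.+1 + (p.+1 - k %/ r.+1)) %% p.+1 * r.+1
                  + (l %% r.+1 + (r.+1 - k %% r.+1)) %% r.+1 in
    all (fun s => [&& size s == m, uniq s & all (gtn n) s]) blocks ->
    sort leq [seq qn (nth 0 s p.1) (nth 0 s p.2) | s <- blocks, p <- edges] =
      [seq d <- iota 0 n | a d] ->
    (forall x y : 'I_p.+1 * 'I_r.+1, w x y = a ((y.1 - x.1)%R * r.+1 + (y.2 - x.2)%R)) ->
  decomposable e w.
Proof.
move=> qn Bok Bsort wE.
pose cod (x : 'I_p.+1 * 'I_r.+1) := x.1 * r.+1 + x.2.
have cod_lt x : cod x < n by have := ltn_ord x.1; have := ltn_ord x.2; rewrite /cod /n; nia.
have cod_inj : injective cod.
  move=> [x x'] [y y'] xy; congr pair; apply/val_inj.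
    by have := congr1 (divn^~ r.+1) xy; rewrite !divnMDl // !divn_small // !addn0.
  by have := congr1 (modn^~ r.+1) xy; rewrite !modnMDl !modn_small.
have subE s (k l : nat) : (inZp l - inZp k : 'I_s.+1)%R = (l + (s.+1 - k %% s.+1)) %% s.+1 :> nat.
  by rewrite /= modnDm.
apply: (@decomposable_develop _ ('I_p.+1 * 'I_r.+1)%type
  (fun g x : 'I_p.+1 * 'I_r.+1 => (x + g)%R)
  (fun x y : 'I_p.+1 * 'I_r.+1 => cod (y - x)%R) n (@label_point p r) qn blocks n a w) => //.
- by move=> g x y /addIr.
- move=> x y x' y'; rewrite (inj_eq cod_inj) (bigD1 (x' - x)%R) //= big1 => [|g].
    rewrite addrCA subrr addr0 eqxx addn0; congr nat_of_bool.
    by rewrite addrCA [RHS]eq_sym subr_eq [RHS]eq_sym [in RHS]addrC.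
  by rewrite eq_sym subr_eq eq_sym addrC => /negPf->.
- exact: label_point_inj.
- move=> k l; rewrite !inE => kn ln; rewrite /cod /qn /label_point.
  rewrite -[X in X * _]/(nat_of_ord (inZp (l %/ r.+1) - inZp (k %/ r.+1))%R).
  rewrite -[X in _ + X]/(nat_of_ord (inZp (l %% r.+1) - inZp (k %% r.+1))%R).
  by rewrite !subE (modn_small (_ : k %/ r.+1 < p.+1)) ?ltn_divLR // modn_mod.
- by move=> x y; rewrite cod_lt wE.
Qed.
End Develop.

(** * Numeric encodings of the rook's graph and of K_4 *)

Definition rook_enc (x : 'I_4 * 'I_4) : nat := 4 * x.1 + x.2.
Definition rook_en : rel nat :=
  fun k l => (k != l) && ((k %/ 4 == l %/ 4) || (k %% 4 == l %% 4)).

Lemma rook_enc_div x : rook_enc x %/ 4 = x.1.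
Proof. by rewrite /rook_enc mulnC divnMDl // divn_small // addn0. Qed.

Lemma rook_enc_mod x : rook_enc x %% 4 = x.2.
Proof. by rewrite /rook_enc mulnC modnMDl modn_small. Qed.

Lemma rook_enc_inj : injective rook_enc.
Proof.
move=> [i j] [k l] E; congr pair; apply/val_inj.
  by have := congr1 (divn^~ 4) E; rewrite !rook_enc_div.
by have := congr1 (modn^~ 4) E; rewrite !rook_enc_mod.
Qed.

Lemma rook_enc_lt x : rook_enc x < 16.
Proof. by have := ltn_ord x.1; have := ltn_ord x.2; rewrite /rook_enc; lia. Qed.

Lemma rook_enE x y : LK44 x y = rook_en (rook_enc x) (rook_enc y).
Proof.
by rewrite /rook_en !rook_enc_div !rook_enc_mod (inj_eq rook_enc_inj).
Qed.

Lemma card_rook : #|{: 'I_4 * 'I_4}| = 16.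
Proof. by rewrite card_prod !card_ord. Qed.

(** A block is a 4 by 4 array read row by row; its edges join entries of one row or one column. *)
Definition rook_table :=
  decomposable_table rook_enc_inj rook_enc_lt card_rook rook_enE.
Definition rook_difference :=
  decomposable_difference rook_enc_inj rook_enc_lt card_rook rook_enE.

Definition K4_en : rel nat := fun k l => k != l.

Lemma K4_enE (u v : 'I_4) : complete u v = K4_en u v.
Proof. by []. Qed.

Definition K4_table :=
  decomposable_table (@ord_inj 4) (@ltn_ord 4) (card_ord 4) K4_enE.
Definition K4_difference :=
  decomposable_difference (@ord_inj 4) (@ltn_ord 4) (card_ord 4) K4_enE.

(** The case of a difference family: each nonzero difference occurs exactly once. For [r = 0] the
    group is cyclic of order [p.+1]. *)
Lemma rook_difference_complete p r (blocks : seq (seq nat)) (n := p.+1 * r.+1) :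
    let qn k l := (l %/ r.+1 + (p.+1 - k %/ r.+1)) %% p.+1 * r.+1
                  + (l %% r.+1 + (r.+1 - k %% r.+1)) %% r.+1 in
    all (fun s => [&& size s == 16, uniq s & all (gtn n) s]) blocks ->
    sort leq [seq qn (nth 0 s p.1) (nth 0 s p.2) | s <- blocks, p <- edges 16 rook_en] =
      [seq d <- iota 0 n | d != 0] ->
  decomposable LK44 (@complete 'I_n).
Proof.
move=> qn Bok Bsort.
have D : decomposable LK44 (@complete ('I_p.+1 * 'I_r.+1)%type).
  apply: (rook_difference Bok Bsort) => x y.
  rewrite /complete addn_eq0 muln_eq0 orbF.
  rewrite -![nat_of_ord _ == 0]/(_ == 0%R :> 'I__.+1) !subr_eq0.
  by rewrite eq_sym -pair_eqE /=; case: (x) (y) => [? ?] [? ?].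
have cardT : #|{: 'I_p.+1 * 'I_r.+1}| = n by rewrite card_prod !card_ord.
move: D; rewrite -{}cardT => D.
apply: (decomposable_bij (h := enum_rank)) D => [|x y]; first exact: enum_rank_bij.
by rewrite /complete (inj_eq enum_rank_inj).
Qed.

(** * Difference families for small t *)

(* When p = 96 t + 1 is prime, a single block is found that is invariant under a
   multiplier of order 3 and whose differences represent the 16 cosets of the
   subgroup of order 6 t of F_p^*; the other blocks are its multiples. For t = 3
   the same is done in the field with 17^2 elements, of additive group Z_17^2. *)
Lemma designable1 : designable 1.
Proof.
by apply: (@rook_difference_complete 96 0
  [:: [:: 0; 53; 12; 32; 70; 6; 54; 40; 25; 42; 16; 47; 2; 93; 15; 75]]); vm_compute.
Qed.

Lemma designable2 : designable 2.
Proof.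
by apply: (@rook_difference_complete 192 0
  [:: [:: 0; 115; 10; 68; 161; 38; 183; 177; 14; 7; 104; 125; 18; 78; 9; 51];
    [:: 0; 38; 104; 51; 169; 125; 89; 181; 107; 150; 78; 142; 110; 155; 55; 183]]); vm_compute.
Qed.

Lemma designable3 : designable 3.
Proof.
by apply: (@rook_difference_complete 16 16
  [:: [:: 0; 240; 95; 260; 141; 118; 84; 144; 158; 182; 140; 153; 7; 69; 286; 65];
    [:: 0; 92; 253; 267; 19; 264; 198; 161; 52; 31; 68; 25; 235; 100; 131; 263];
    [:: 0; 111; 16; 196; 224; 54; 113; 194; 67; 197; 149; 219; 32; 280; 204; 103]]); vm_compute.
Qed.

Lemma designable6 : designable 6.
Proof.
by apply: (@rook_difference_complete 576 0
  [:: [:: 0; 138; 472; 544; 4; 271; 291; 350; 298; 110; 283; 42; 275; 244; 117; 23];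
    [:: 0; 477; 51; 49; 64; 297; 40; 407; 152; 29; 489; 95; 361; 442; 141; 368];
    [:: 0; 131; 239; 207; 447; 136; 63; 165; 124; 464; 323; 366; 6; 148; 525; 118];
    [:: 0; 365; 362; 427; 228; 445; 431; 332; 253; 500; 552; 86; 96; 60; 322; 157];
    [:: 0; 70; 22; 485; 186; 196; 549; 119; 9; 499; 177; 222; 382; 383; 536; 204];
    [:: 0; 543; 352; 259; 91; 251; 129; 173; 144; 483; 524; 90; 342; 358; 498; 379]]); vm_compute.
Qed.

Lemma designable7 : designable 7.
Proof.
by apply: (@rook_difference_complete 672 0
  [:: [:: 0; 472; 566; 308; 74; 336; 223; 72; 26; 189; 209; 333; 573; 117; 412; 128];
    [:: 0; 82; 47; 544; 87; 104; 53; 503; 649; 395; 273; 55; 610; 565; 448; 296];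
    [:: 0; 442; 319; 585; 75; 577; 417; 364; 281; 619; 421; 1; 317; 255; 363; 348];
    [:: 0; 265; 275; 133; 552; 451; 81; 337; 103; 464; 595; 465; 18; 127; 545; 300];
    [:: 0; 66; 5; 602; 267; 412; 650; 569; 112; 400; 72; 192; 294; 504; 377; 189];
    [:: 0; 405; 306; 635; 323; 448; 73; 96; 259; 252; 503; 444; 91; 156; 325; 395];
    [:: 0; 558; 287; 501; 116; 363; 295; 222; 641; 78; 364; 522; 589; 529; 373; 619]]); vm_compute.
Qed.

(** * Decompositions of the multipartite ingredients *)

(* Label 4 p + u is the point (p, u) of the affine plane over F_4. *)
Lemma K4_4_LK44 : decomposable LK44 (@blowup 'I_4 (@complete 'I_4) 'I_4).
Proof.
apply: (@rook_table 3 3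
  [:: [:: 0; 5; 10; 15; 4; 1; 14; 11; 8; 13; 2; 7; 12; 9; 6; 3];
    [:: 0; 6; 11; 13; 7; 1; 12; 10; 9; 15; 2; 4; 14; 8; 5; 3]]
  (fun k l => k %/ 4 != l %/ 4)) => [||x y];
  [by vm_compute | by vm_compute |].
by rewrite !divnMDl // !divn_small // !addn0.
Qed.

(* Translates of one block by Z_2^3. *)
Lemma K4_8_LK44 : decomposable LK44 (@multipartite 'I_5 'I_8 (fun i _ => i < 4)).
Proof.
(* The fifth group, with labels 32 to 39, stays isolated as in [multipartite24 4]. *)
apply: (@rook_table 4 7
  [:: [:: 3; 10; 18; 31; 15; 5; 30; 16; 17; 24; 6; 11; 25; 19; 14; 0];
    [:: 2; 11; 19; 30; 14; 4; 31; 17; 16; 25; 7; 10; 24; 18; 15; 1];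
    [:: 1; 8; 16; 29; 13; 7; 28; 18; 19; 26; 4; 9; 27; 17; 12; 2];
    [:: 0; 9; 17; 28; 12; 6; 29; 19; 18; 27; 5; 8; 26; 16; 13; 3];
    [:: 7; 14; 22; 27; 11; 1; 26; 20; 21; 28; 2; 15; 29; 23; 10; 4];
    [:: 6; 15; 23; 26; 10; 0; 27; 21; 20; 29; 3; 14; 28; 22; 11; 5];
    [:: 5; 12; 20; 25; 9; 3; 24; 22; 23; 30; 0; 13; 31; 21; 8; 6];
    [:: 4; 13; 21; 24; 8; 2; 25; 23; 22; 31; 1; 12; 30; 20; 9; 7]]
  (fun k l => [&& k %/ 8 < 4, l %/ 8 < 4 & k %/ 8 != l %/ 8])) => [||x y];
  [by vm_compute | by vm_compute |].
by rewrite !divnMDl // !divn_small // !addn0.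
Qed.

(* Four base blocks over Z_30 with groups x mod 5, developed by x -> x + 2. *)
Lemma K5_6_K4 : decomposable (@complete 'I_4) (@multipartite 'I_5 'I_6 (fun _ _ => true)).
Proof.
(* The element x of Z_30 has the label 6 (x mod 5) + (x div 5), so that groups are read off by
   division by 6. *)
apply: (@K4_table 4 5
  [:: [:: 19; 12; 6; 0];
    [:: 2; 24; 18; 12];
    [:: 14; 7; 1; 24];
    [:: 26; 19; 13; 7];
    [:: 9; 2; 25; 19];
    [:: 21; 14; 8; 2];
    [:: 4; 26; 20; 14];
    [:: 16; 9; 3; 26];
    [:: 28; 21; 15; 9];
    [:: 11; 4; 27; 21];
    [:: 23; 16; 10; 4];
    [:: 0; 28; 22; 16];
    [:: 12; 11; 5; 28];
    [:: 24; 23; 17; 11];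
    [:: 7; 0; 29; 23];
    [:: 9; 20; 24; 0];
    [:: 21; 3; 7; 12];
    [:: 4; 15; 19; 24];
    [:: 16; 27; 2; 7];
    [:: 28; 10; 14; 19];
    [:: 11; 22; 26; 2];
    [:: 23; 5; 9; 14];
    [:: 0; 17; 21; 26];
    [:: 12; 29; 4; 9];
    [:: 24; 6; 16; 21];
    [:: 7; 18; 28; 4];
    [:: 19; 1; 11; 16];
    [:: 2; 13; 23; 28];
    [:: 14; 25; 0; 11];
    [:: 26; 8; 12; 23];
    [:: 27; 15; 8; 0];
    [:: 10; 27; 20; 12];
    [:: 22; 10; 3; 24];
    [:: 5; 22; 15; 7];
    [:: 17; 5; 27; 19];
    [:: 29; 17; 10; 2];
    [:: 6; 29; 22; 14];
    [:: 18; 6; 5; 26];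
    [:: 1; 18; 17; 9];
    [:: 13; 1; 29; 21];
    [:: 25; 13; 6; 4];
    [:: 8; 25; 18; 16];
    [:: 20; 8; 1; 28];
    [:: 3; 20; 13; 11];
    [:: 15; 3; 25; 23];
    [:: 15; 20; 2; 6];
    [:: 27; 3; 14; 18];
    [:: 10; 15; 26; 1];
    [:: 22; 27; 9; 13];
    [:: 5; 10; 21; 25];
    [:: 17; 22; 4; 8];
    [:: 29; 5; 16; 20];
    [:: 6; 17; 28; 3];
    [:: 18; 29; 11; 15];
    [:: 1; 6; 23; 27];
    [:: 13; 18; 0; 10];
    [:: 25; 1; 12; 22];
    [:: 8; 13; 24; 5];
    [:: 20; 25; 7; 17];
    [:: 3; 8; 19; 29]]
  (fun k l => k %/ 6 != l %/ 6)) => [||x y];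
  [by vm_compute | by vm_compute |].
by rewrite !divnMDl // !divn_small // !addn0.
Qed.

(* Four base blocks over Z_24 x Z_11, multiplied by the squares of Z_11. *)
Lemma K11_24_K4 :
  decomposable (@complete 'I_4) (fun x y : 'I_24 * 'I_11 => x.2 != y.2).
Proof.
apply: (@K4_difference 23 10
  [:: [:: 0; 229; 7; 173];
    [:: 0; 240; 250; 116];
    [:: 0; 218; 12; 190];
    [:: 0; 76; 160; 194];
    [:: 0; 225; 10; 167];
    [:: 0; 236; 244; 117];
    [:: 0; 214; 14; 196];
    [:: 0; 74; 161; 197];
    [:: 0; 224; 8; 171];
    [:: 0; 235; 248; 120];
    [:: 0; 213; 20; 192];
    [:: 0; 68; 164; 195];
    [:: 0; 221; 2; 172];
    [:: 0; 232; 249; 118];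
    [:: 0; 210; 16; 191];
    [:: 0; 72; 162; 189];
    [:: 0; 223; 6; 175];
    [:: 0; 234; 252; 112];
    [:: 0; 212; 15; 188];
    [:: 0; 73; 156; 193]]
  (fun d => d %% 11 != 0)) => [||x y]; [by vm_compute | by vm_compute |].
rewrite modnMDl modn_small //.
by rewrite -[nat_of_ord _ == 0]/(_ == 0%R :> 'I_11) subr_eq0 eq_sym.
Qed.

(** Weight 4 turns groups of size 6 into groups of size 24 and each block K_4 into K_4[4]. *)
Lemma multipartite24_5 : multipartite24 5.
Proof.
have := decomposable_blowup K5_6_K4 K4_4_LK44.
pose h (x : ('I_5 * 'I_6) * 'I_4) := (x.1.1, (x.1.2, x.2)).
move=> /(@decomposable_bij _ _ _ _ h _
  (@multipartite 'I_5 ('I_6 * 'I_4)%type (fun i _ => i < 5))) D.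
apply: (@decomposable_multipartite_card _ _ ('I_6 * 'I_4)%type _ _ (fun i : 'I_5 => i < 5)).
  by rewrite card_prod !card_ord.
apply: D => [|x y]; last by rewrite /blowup /multipartite /= !ltn_ord.
by exists (fun y => ((y.1, y.2.1), y.2.2)) => [[[]]|[? []]].
Qed.

(** A transversal design with four groups of size 3, whose rows are [a], [a + b], [a + 2 * b] and
    [b] modulo 3, is given weight 8. *)
Lemma multipartite24_4 : multipartite24 4.
Proof.
have [T [f tf cardT]] : has_transversal 4 3.
  by apply: (@has_transversal_table 4 3
    (fun i a b => if i < 3 then (a + i * b) %% 3 else b)); vm_compute.
apply: (@decomposable_multipartite_card _ _ (T * 'I_8)%type _ _ (fun i : 'I_5 => i < 4)).
  by rewrite card_prod cardT !card_ord.
apply: (decomposable_transversal (f := f) (P := fun i _ => i < 4)) => [i j _ _|ab].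
  by move=> nij i4 j4; apply: tf.
exact: K4_8_LK44.
Qed.

(** Weight 4 turns the 11 groups of size 24 into groups of size 96, which are filled with designs of
    order 97. *)
Lemma designable11 : designable 11.
Proof.
have := decomposable_blowup K11_24_K4 K4_4_LK44.
pose h (x : ('I_24 * 'I_11) * 'I_4) := (x.1.2, (x.1.1, x.2)).
pose P (i : 'I_11) (x : 'I_24 * 'I_4) := true.
move=> /(@decomposable_bij _ _ _ _ h _ (multipartite P)) D.
have cardP i : #|P i| = 96 by rewrite cardT -cardE card_prod !card_ord.
rewrite /designable (_ : 96 * 11 = \sum_i #|P i|); last first.
  by under eq_bigr do rewrite cardP; rewrite sum_nat_const card_ord.
apply: decomposable_fill => [||i]; [exact: LK44_no_isolated| |].
  apply: D => //.
  by exists (fun y => ((y.2.1, y.1), y.2.2)) => [[[]]|[? []]].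
by rewrite cardP; exact: designable1.
Qed.

(** * Transversal designs with groups of size 4 m *)

(* Difference matrices over Z_2^a x Z_r, with (e, y) encoded as r * e + y: the
   rows 0, x, s x, t x and all their differences are permutations of the group. *)
Definition dm_add r k l := r * Nat.lxor (k %/ r) (l %/ r) + (k %% r + l %% r) %% r.
Definition dm_column r (s t : seq nat) (i a b : nat) : nat :=
  nth 0 [:: a; dm_add r a b; dm_add r a (nth 0 s b); dm_add r a (nth 0 t b); b] i.

(** The two lists are multiplication in F_4 by the elements 3 and 2, addition being [xor]; the five
    rows give the parallel classes of AG(2,4). *)
Lemma has_transversal4 : has_transversal 5 4.
Proof.
by apply: (@has_transversal_table 5 4 (dm_column 1 [:: 0; 3; 1; 2] [:: 0; 2; 3; 1]));
  vm_compute.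
Qed.

Lemma has_transversal8 : has_transversal 5 8.
Proof.
by apply: (@has_transversal_table 5 8
  (dm_column 1 [:: 0; 6; 3; 5; 7; 1; 4; 2] [:: 0; 4; 5; 1; 2; 6; 7; 3])); vm_compute.
Qed.

Lemma has_transversal12 : has_transversal 5 12.
Proof.
by apply: (@has_transversal_table 5 12
  (dm_column 3 [:: 0; 3; 8; 5; 9; 7; 1; 4; 11; 10; 2; 6]
               [:: 0; 10; 6; 2; 5; 11; 9; 3; 7; 1; 8; 4])); vm_compute.
Qed.

Lemma has_transversal24 : has_transversal 5 24.
Proof.
by apply: (@has_transversal_table 5 24
  (dm_column 3
    [:: 13; 7; 22; 0; 12; 23; 1; 14; 10; 19; 8; 2;
        9; 18; 5; 20; 16; 15; 6; 17; 3; 11; 21; 4]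
    [:: 15; 23; 2; 9; 8; 16; 5; 13; 10; 7; 17; 18;
        1; 12; 19; 6; 0; 20; 21; 14; 4; 22; 3; 11])); vm_compute.
Qed.

Lemma has_transversal_coprime m : 0 < m -> coprime m 6 -> has_transversal 5 (4 * m).
Proof.
by move=> m0 m6; apply: has_transversalM has_transversal4 (has_transversal_linear m0 m6).
Qed.

(** The largest [m] prime to 6 with [4 * m <= t] works: the next such number is at most [m + 4], so
    [t <= 4 * m + 15], and [m >= 19]. *)
Lemma coprime6_between t : 76 <= t -> exists2 m, coprime m 6 & 4 * m <= t <= 5 * m.
Proof.
move=> t76; pose k := t %/ 24.
have c1 j : coprime (6 * j + 1) 6 by rewrite mulnC /coprime gcdnC gcdnMDl.
have c5 j : coprime (6 * j + 5) 6 by rewrite mulnC /coprime gcdnC gcdnMDl.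
have [t4|t4] := ltnP (t %% 24) 4.
  by exists (6 * k.-1 + 5) => //; rewrite /k; lia.
have [t20|t20] := ltnP (t %% 24) 20.
  by exists (6 * k + 1) => //; rewrite /k; lia.
by exists (6 * k + 5) => //; rewrite /k; lia.
Qed.

Lemma designable_all t : designable t.
Proof.
have step := designable_step multipartite24_4 multipartite24_5.
elim/ltn_ind: t => t IH.
(* The recursive step with [s = t - 4 * m]; both [m] and [s] are below [t]. *)
have use m : 0 < m -> 4 * m <= t <= 5 * m -> has_transversal 5 (4 * m) -> designable t.
  move=> m0 mt tm; rewrite (_ : t = 4 * m + (t - 4 * m)); last by lia.
  by apply: step => //; [lia | apply: IH; lia | apply: IH; lia].
have usec m : coprime m 6 -> 0 < m -> 4 * m <= t <= 5 * m -> designable t.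
  by move=> m6 m0 mt; apply: use mt _ => //; apply: has_transversal_coprime.
have [t76|t76] := leqP 76 t.
  have [m m6 mt] := coprime6_between t76.
  by have m0 : 0 < m; [lia | exact: usec m6 m0 mt].
have t4 := has_transversal4; have t8 := has_transversal8.
have [->|n0] := eqVneq t 0.
  (* K_1 has the empty decomposition. *)
  by exists [::] => // x y; rewrite /complete !ord1 eqxx.
have [->|n1] := eqVneq t 1; first exact: designable1.
have [->|n2] := eqVneq t 2; first exact: designable2.
have [->|n3] := eqVneq t 3; first exact: designable3.
have [->|n6] := eqVneq t 6; first exact: designable6.
have [->|n7] := eqVneq t 7; first exact: designable7.
have [->|n11] := eqVneq t 11; first exact: designable11.
(* The intervals from [4 * m] to [5 * m], for the values of [m] used below, contain all remaining
   [t < 76]. *)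
have [t5|t5] := leqP t 5; first by apply: (usec 1) => //; lia.
have [t10|t10] := leqP t 10; first by apply: (use 2 _ _ t8) => //; lia.
have [t15|t15] := leqP t 15.
  by apply: (use 3 _ _ has_transversal12) => //; lia.
have [t20|t20] := leqP t 20.
  by apply: (use 4 _ _ (has_transversalM t4 t4)) => //; lia.
have [t25|t25] := leqP t 25; first by apply: (usec 5) => //; lia.
have [t30|t30] := leqP t 30.
  by apply: (use 6 _ _ has_transversal24) => //; lia.
have [t35|t35] := leqP t 35; first by apply: (usec 7) => //; lia.
have [t40|t40] := leqP t 40.
  by apply: (use 8 _ _ (has_transversalM t4 t8)) => //; lia.
have [t50|t50] := leqP t 50.
  apply: (use 10) => //; first by lia.
  exact: (has_transversalM t8 (has_transversal_linear (m := 5) _ _)).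
have [t55|t55] := leqP t 55; first by apply: (usec 11) => //; lia.
have [t65|t65] := leqP t 65; first by apply: (usec 13) => //; lia.
by apply: (use 16 _ _ (has_transversalM t8 t8)) => //; lia.
Qed.

(** * Passage to designs, and the divisibility conditions *)

Lemma designable_has_design t : designable t -> has_design LK44 (96 * t).+1.
Proof.
move=> [L Linj cL]; exists L; split=> // u v nuv.
by have := cL u v; rewrite /complete nuv.
Qed.

Lemma LK44_regular x : \sum_y LK44 x y = 6.
Proof.
under eq_bigr => y _ do rewrite rook_enE.
rewrite (sum_enc rook_enc_inj rook_enc_lt card_rook (fun l => rook_en (rook_enc x) l)).
have : all (fun k => count (rook_en k) (iota 0 16) == 6) (iota 0 16) by vm_compute.
move/allP => /(_ (rook_enc x)); rewrite mem_iota rook_enc_lt => /(_ isT)/eqP deg6.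
rewrite -[RHS]deg6 -sum1_count [RHS]big_mkcond.
by apply: eq_bigr => l _; case: rook_en.
Qed.

(** The vertex sent to [u], if there is one, contributes its six neighbours. *)
Lemma sum_covers_LK44 (T : finType) (f : {ffun 'I_4 * 'I_4 -> T}) u : injective f ->
  \sum_v covers LK44 f u v = 6 * \sum_x (f x == u).
Proof.
move=> f_inj; under eq_bigr => v _ do rewrite (covers_sum _ _ _ f_inj).
rewrite exchange_big big_distrr /=; apply: eq_bigr => x _.
rewrite exchange_big -(LK44_regular x) big_distrl /=; apply: eq_bigr => y _.
rewrite -big_distrr /= (bigD1 (f y)) //= eqxx andbT big1 ?addn0 // => v nv.
by rewrite (eq_sym (f y)) (negPf nv) andbF.
Qed.

Lemma has_design_mod n : has_design LK44 n.+1 -> n.+1 = 1 %[mod 96].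
Proof.
move=> [s [s_inj s_count]].
have degree u : n = 6 * \sum_(f <- s) \sum_x (f x == u).
  transitivity (\sum_v count (fun f : {ffun 'I_4 * 'I_4 -> 'I_n.+1} => covers LK44 f u v) s).
    (* The term [v = u] vanishes because blocks are injective; the other [n] terms are 1. *)
    rewrite (bigD1 u) //= (_ : count _ _ = 0).
      under eq_bigr => v nv do rewrite s_count 1?eq_sym //.
      by rewrite sum1_card cardC1 card_ord.
    apply/eqP; rewrite -leqn0 leqNgt -has_count; apply/hasPn => f /(allP s_inj)/injectiveP f_inj.
    by apply/coversP => -[x [y [/andP[nxy _] fx fy]]]; case/eqP: nxy; apply: f_inj; rewrite fx fy.
  under eq_bigr => v _ do rewrite -sum1_count big_mkcond.
  rewrite exchange_big big_distrr /=; apply: eq_big_seq => f /(allP s_inj)/injectiveP f_inj.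
  by rewrite -sum_covers_LK44 //; apply: eq_bigr => v _; case: covers.
(* Summing the degrees over [u]: each copy has 16 vertices of degree 6. *)
have total : n.+1 * n = 96 * size s.
  rewrite -[X in X * _]card_ord -sum_nat_const (eq_bigr _ (fun u _ => degree u)).
  rewrite -big_distrr exchange_big /= (eq_bigr (fun=> 16)) => [|f _].
    by rewrite big_const_seq count_predT iter_addn_0; lia.
  rewrite exchange_big (eq_bigr (fun=> 1)) => [|x _].
    by rewrite sum1_card card_rook.
  by rewrite (bigD1 (f x)) //= eqxx big1 // => v nv; rewrite eq_sym (negPf nv).
have n6 : 6 %| n by rewrite (degree ord0) dvdn_mulr.
(* As 6 divides [n], neither 2 nor 3 divides [n.+1]. *)
have cop : coprime 96 n.+1.
  rewrite -[96]/(3 * 2 ^ 5) coprimeMl coprimeXl ?andbT prime_coprime //; lia.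
have : 96 %| n by rewrite -(Gauss_dvdr _ cop) total dvdn_mulr.
by case/dvdnP => k ->; rewrite -addn1 modnMDl.
Qed.

Theorem theorem3p1 (n : nat) : 0 < n ->
  (has_design LK44 n <-> n = 1 %[mod 96]).
Proof.
case: n => // n _; split; first exact: has_design_mod.
move=> n1; have /dvdnP[t ->] : 96 %| n by lia.
by rewrite mulnC; apply/designable_has_design/designable_all.
Qed.
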